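(* Let $n\geq 2$ and $\ell\geq 2$ be integers, and let $H$ be a graph that is both $\ell$-distance-balanced and $(\ell-1)$-distance-balanced. Then the Cartesian product $K_n\,\square\,H$ is $\ell$-distance-balanced if and only if $$|\{h\in W_{h_1h_2}: d_H(h_1,h)=d_H(h_2,h)-1\}|=|\{h\in W_{h_2h_1}: d_H(h_2,h)=d_H(h_1,h)-1\}|$$ for every $h_1,h_2\in V(H)$ with $d_H(h_1,h_2)=\ell-1$.
   Context: All graphs are finite, simple, undirected and connected. $d_G$ denotes the geodesic distance in $G$ and $\mathrm{diam}(G)$ the maximum distance between pairs of vertices of $G$. For vertices $u,v$ of $G$, $W_{uv}=\{w\in V(G): d_G(w,u)<d_G(w,v)\}$. For a positive integer $\ell$, a graph $G$ with $\mathrm{diam}(G)\geq\ell$ is $\ell$-distance-balanced if $|W_{uv}|=|W_{vu}|$ for all $u,v\in V(G)$ with $d_G(u,v)=\ell$. $K_n$ is the complete graph on $n$ vertices. The Cartesian product $G\,\square\,H$ has vertex set $V(G)\times V(H)$, and $(g_1,h_1)$ and $(g_2,h_2)$ are adjacent if either $g_1=g_2$ and $h_1h_2\in E(H)$, or $h_1=h_2$ and $g_1g_2\in E(G)$. *)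

(* Defs.v *)
From mathcomp Require Import all_boot.

Set Implicit Arguments.
Unset Strict Implicit.
Unset Printing Implicit Defensive.

Record graph := Graph {
  vertex :> finType;
  adj : rel vertex;
  adj_sym : symmetric adj;
  adj_irr : irreflexive adj;
  adj_connected : forall u v : vertex, connect adj u v
}.

(* The tuple [p] lists the vertices of a walk after its first vertex [u], so
   its size [k] is the number of edges. *)
Definition has_walk (G : graph) (u v : G) (k : nat) : bool :=
  [exists p : k.-tuple G, path (@adj G) u p && (last u p == v)].

Lemma ex_walk (G : graph) (u v : G) : exists k, has_walk u v k.
Proof.
have /connectP[p up ->] := adj_connected u v.
by exists (size p); apply/existsP; exists (in_tuple p); rewrite up eqxx.
Qed.

Definition dist (G : graph) (u v : G) : nat := ex_minn (ex_walk u v).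

Definition diam (G : graph) : nat := \max_(u : G) \max_(v : G) dist u v.

(* Membership of [w] forces [0 < dist w v], so the truncated [dist w v - 1] is
   the true predecessor there. *)
Definition W (G : graph) (u v : G) : {set G} :=
  [set w | dist w u < dist w v].

Definition distance_balanced (l : nat) (G : graph) : Prop :=
  l <= diam G /\
  forall u v : G, dist u v = l -> #|W u v| = #|W v u|.

Definition complete_adj (n : nat) : rel 'I_n := fun x y => x != y.

Lemma complete_sym n : symmetric (@complete_adj n).
Proof. by move=> x y; rewrite /complete_adj eq_sym. Qed.

Lemma complete_irr n : irreflexive (@complete_adj n).
Proof. by move=> x; rewrite /complete_adj eqxx. Qed.

Lemma complete_connected n (x y : 'I_n) : connect (@complete_adj n) x y.
Proof. by have [->|xy] := eqVneq x y; [exact: connect0 | exact: connect1]. Qed.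

Definition complete_graph (n : nat) : graph :=
  Graph (@complete_sym n) (@complete_irr n) (@complete_connected n).

Definition cart_adj (G H : graph) : rel (G * H) := fun x y =>
  (x.1 == y.1) && adj x.2 y.2 || (x.2 == y.2) && adj x.1 y.1.

Lemma cart_sym (G H : graph) : symmetric (@cart_adj G H).
Proof.
move=> x y; rewrite /cart_adj [y.1 == _]eq_sym [y.2 == _]eq_sym.
by rewrite [adj y.1 _]adj_sym [adj y.2 _]adj_sym.
Qed.

Lemma cart_irr (G H : graph) : irreflexive (@cart_adj G H).
Proof. by move=> x; rewrite /cart_adj !adj_irr !andbF. Qed.

Lemma cart_connected (G H : graph) (x y : G * H) :
  connect (@cart_adj G H) x y.
Proof.
case: x y => [g1 h1] [g2 h2]; apply: (@connect_trans _ _ (g1, h2)).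
  have /connectP[p hp ->] := adj_connected h1 h2.
  elim: p h1 hp => [|h p IHp] h1 /=; first by rewrite connect0.
  move=> /andP[h1h /IHp]; apply: connect_trans; apply: connect1.
  by rewrite /cart_adj /= eqxx h1h.
have /connectP[p gp ->] := adj_connected g1 g2.
elim: p g1 gp => [|g p IHp] g1 /=; first by rewrite connect0.
move=> /andP[g1g /IHp]; apply: connect_trans; apply: connect1.
by rewrite /cart_adj /= eqxx g1g orbT.
Qed.

Definition cartesian_product (G H : graph) : graph :=
  Graph (@cart_sym G H) (@cart_irr G H) (@cart_connected G H).

(* Main.v *)
Require Import Defs.
From mathcomp Require Import all_boot.
From mathcomp Require Import zify.

Set Implicit Arguments.
Unset Strict Implicit.
Unset Printing Implicit Defensive.

(** Distances add up in a Cartesian product, so in the product of [K_n] and [H]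
    the distance of [(g1, h1)] and [(g2, h2)] is [d_H(h1, h2)] plus one if [g1]
    and [g2] differ ([dist_product], [dist_complete]).  Hence pairs at distance
    [l] are of two kinds.

    If [g1 = g2] and [d_H(h1, h2) = l], then every copy of [H] meets
    [W_{(g1, h1)(g2, h2)}] in a copy of [W_{h1 h2}], and [l]-balance of [H]
    settles the matter ([card_W_same_layer]).

    If [g1 <> g2] and [d_H(h1, h2) = l - 1], then the [n - 2] copies of [H]
    over other vertices still contribute [|W_{h1 h2}|] each.  The copy over
    [g1] also gains the set [E] of vertices equidistant from [h1] and [h2],
    while the copy over [g2] loses the set [D_{h1 h2}] of vertices closer to
    [h1] by exactly one.  So the cardinality of the half-space is
    [n |W_{h1 h2}| + |E| - |D_{h1 h2}|] ([card_W_distinct_layers]).  Since [E]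
    is symmetric in [h1] and [h2] and [H] is [(l - 1)]-balanced, the two
    opposite half-spaces have equal size exactly when
    [|D_{h1 h2}| = |D_{h2 h1}|].  As [n >= 2], every pair of vertices of [H] at
    distance [l - 1] does arise in this way.  The diameter condition is
    inherited from [H], whose copies in the product are isometric
    ([diam_isometry]). *)

(** * Distance in a graph *)

Section Distance.
Variable G : graph.
Implicit Types (u v w : G) (p : seq G).

Lemma dist_path_le u p : path (@adj G) u p -> dist u (last u p) <= size p.
Proof.
move=> up; rewrite /dist; case: ex_minnP => m _; apply.
by apply/existsP; exists (in_tuple p); rewrite up eqxx.
Qed.

Lemma geodesic u v :
  exists p, [/\ path (@adj G) u p, last u p = v & size p = dist u v].
Proof.
rewrite /dist; case: ex_minnP => m /existsP[p /andP[up /eqP lp]] _.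
by exists p; rewrite size_tuple.
Qed.

Lemma dist_triangle u w v : dist u v <= dist u w + dist w v.
Proof.
have [p [up <- <-]] := geodesic u w.
have [q [wq <- <-]] := geodesic (last u p) v.
by rewrite -last_cat -size_cat dist_path_le // cat_path up.
Qed.

Lemma dist_sym u v : dist u v = dist v u.
Proof.
suff le_sym (x y : G) : dist x y <= dist y x.
  by apply/eqP; rewrite eqn_leq !le_sym.
have [p [yp <- <-]] := geodesic y x.
have := @dist_path_le (last y p) (rev (belast y p)).
rewrite size_rev size_belast rev_path (eq_path (e' := @adj G)); last first.
  by move=> a b; rewrite adj_sym.
by case: p yp => [|z p] yp; rewrite ?belast_cat /= ?rev_cons ?last_rcons; apply.
Qed.

Lemma dist_refl u : dist u u = 0.
Proof. by apply/eqP; rewrite -leqn0 (@dist_path_le u [::]). Qed.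

Lemma dist_adj_le u v : adj u v -> dist u v <= 1.
Proof. by move=> uv; apply: (@dist_path_le u [:: v]); rewrite /= uv. Qed.

Lemma dist_gt0 u v : u != v -> 0 < dist u v.
Proof.
by have [[|w p] [_ /= <- <-]] := geodesic u v; rewrite ?eqxx.
Qed.

Lemma dist_le_diam u v : dist u v <= diam G.
Proof.
exact: leq_trans (leq_bigmax (F := dist u) v)
                 (leq_bigmax (F := fun x => \max_(y : G) dist x y) u).
Qed.

End Distance.

Lemma dist_homo (G H : graph) (f : G -> H) (u v : G) :
  {homo f : x y / adj x y} -> dist (f u) (f v) <= dist u v.
Proof.
move=> fadj; have [p [up <- <-]] := geodesic u v.
rewrite -last_map -(size_map f) dist_path_le //.
exact: homo_path up.
Qed.

Lemma diam_isometry (G H : graph) (f : G -> H) :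
  (forall u v, dist (f u) (f v) = dist u v) -> diam G <= diam H.
Proof.
move=> fdist; apply/bigmax_leqP => u _; apply/bigmax_leqP => v _.
by rewrite -fdist dist_le_diam.
Qed.

(** * Cartesian products and complete graphs *)

(** A walk changes one coordinate per step, so its length bounds the sum of
    the two distances; conversely, a geodesic in a layer parallel to [H]
    followed by one in a layer parallel to [G] attains that sum. *)
Lemma dist_product (G H : graph) (x y : cartesian_product G H) :
  dist x y = dist x.1 y.1 + dist x.2 y.2.
Proof.
apply/eqP; rewrite eqn_leq; apply/andP; split.
  case: x y => [g1 h1] [g2 h2] /=.
  have embed_l : {homo (fun g => (g, h2) : cartesian_product G H)
                   : a b / adj a b}.
    by move=> a b ab; rewrite /adj /= /cart_adj /= eqxx ab orbT.
  have embed_r : {homo (fun h => (g1, h) : cartesian_product G H)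
                   : a b / adj a b}.
    by move=> a b ab; rewrite /adj /= /cart_adj /= eqxx ab.
  rewrite addnC.
  apply: leq_trans (@dist_triangle (cartesian_product G H) _ (g1, h2) _) _.
  exact: leq_add (dist_homo h1 h2 embed_r) (dist_homo g1 g2 embed_l).
have [p [xp <- <-]] := geodesic x y.
elim: p x xp => [|z p IHp] x /=; first by rewrite !dist_refl.
case/andP=> xz /IHp le_zt.
apply: leq_trans (leq_add (dist_triangle _ z.1 _) (dist_triangle _ z.2 _)) _.
rewrite addnACA -add1n leq_add {le_zt}//.
case/orP: xz => /andP[/eqP-> /dist_adj_le]; by rewrite dist_refl ?addn0.
Qed.

Lemma dist_complete n (x y : complete_graph n) : dist x y = (x != y).
Proof.
have [->|xy] := eqVneq x y; first exact: dist_refl.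
by apply/eqP; rewrite eqn_leq dist_gt0 // dist_adj_le.
Qed.

Lemma card_layers (A B : finType) (S : {set A * B}) :
  #|S| = \sum_(a : A) #|[set b | (a, b) \in S]|.
Proof.
under eq_bigr do rewrite -sum1dep_card.
by rewrite pair_big_dep -sum1_card; apply: eq_bigl => -[a b].
Qed.

(** * Half-spaces of the product with a complete graph *)

Section HalfSpaces.
Variables (n : nat) (H : graph).
Local Notation K := (complete_graph n).
Local Notation KH := (cartesian_product K H).
Implicit Types (g : K) (h : H).

Lemma dist_KH g1 g2 h1 h2 :
  @dist KH (g1, h1) (g2, h2) = (g1 != g2) + dist h1 h2.
Proof. by rewrite dist_product dist_complete. Qed.

Lemma card_W_same_layer g h1 h2 :
  #|@W KH (g, h1) (g, h2)| = n * #|W h1 h2|.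
Proof.
rewrite card_layers -[in RHS](card_ord n) -sum_nat_const.
apply: eq_bigr => a _; congr #|pred_of_set _|; apply/setP=> h.
by rewrite !inE !dist_KH ltn_add2l.
Qed.

Definition closer_by_one h1 h2 : {set H} :=
  [set h in W h1 h2 | dist h1 h == dist h2 h - 1].

Definition equidistant h1 h2 : {set H} := [set h | dist h h1 == dist h h2].

Lemma equidistantC h1 h2 : equidistant h1 h2 = equidistant h2 h1.
Proof. by apply/setP=> h; rewrite !inE eq_sym. Qed.

(** The extra edge from [g1] to [g2] shifts the comparison of distances by one:
    the layer over [g1] gains the equidistant vertices and the layer over [g2]
    loses those closer to [h1] by exactly one.  The loss is put on the left to
    keep clear of truncated subtraction. *)
Lemma card_W_distinct_layers g1 g2 h1 h2 : g1 != g2 ->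
  #|@W KH (g1, h1) (g2, h2)| + #|closer_by_one h1 h2| =
  n * #|W h1 h2| + #|equidistant h1 h2|.
Proof.
move=> g12; have g21 : g2 != g1 by rewrite eq_sym.
rewrite card_layers -[in RHS](card_ord n) -sum_nat_const.
have split_layers (F : K -> nat) : \sum_g F g =
    F g1 + (F g2 + \sum_(g | (g != g1) && (g != g2)) F g).
  by rewrite (bigD1 g1) // (bigD1 g2).
rewrite !split_layers.
rewrite [X in _ + (_ + X)](eq_bigr (fun=> #|W h1 h2|)); last first.
  move=> g /andP[/negPf gg1 /negPf gg2]; congr #|pred_of_set _|.
  by apply/setP=> h; rewrite !inE !dist_KH gg1 gg2.
have layer1 : #|[set h | (g1, h) \in @W KH (g1, h1) (g2, h2)]| =
              #|W h1 h2| + #|equidistant h1 h2|.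
  rewrite -cardsUI [W _ _ :&: _](_ : _ = set0) ?cards0 ?addn0; last first.
    by apply/setP=> h; rewrite !inE; lia.
  congr #|pred_of_set _|; apply/setP=> h.
  by rewrite !inE !dist_KH eqxx g12; lia.
have layer2 : #|[set h | (g2, h) \in @W KH (g1, h1) (g2, h2)]| +
              #|closer_by_one h1 h2| = #|W h1 h2|.
  rewrite -cardsUI [_ :&: closer_by_one _ _](_ : _ = set0) ?cards0 ?addn0;
    last first.
    apply/setP=> h; rewrite !inE !dist_KH eqxx g21.
    by rewrite (dist_sym h1) (dist_sym h2); lia.
  congr #|pred_of_set _|; apply/setP=> h; rewrite !inE !dist_KH eqxx g21.
  by rewrite (dist_sym h1) (dist_sym h2); lia.
(* Bring the missing vertices next to the layer over [g2]. *)
by rewrite layer1 [LHS](AC (2*2*1) (1*((3*5)*4)*2)) /= layer2.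
Qed.

End HalfSpaces.

Theorem theorem5p2 (n l : nat) (H : graph) :
  2 <= n -> 2 <= l ->
  distance_balanced l H -> distance_balanced (l - 1) H ->
  (distance_balanced l (cartesian_product (complete_graph n) H) <->
   forall h1 h2 : H, dist h1 h2 = l - 1 ->
     #|[set h in W h1 h2 | dist h1 h == dist h2 h - 1]| =
     #|[set h in W h2 h1 | dist h2 h == dist h1 h - 1]|).
Proof.
move=> n2 l2 [diamH balH] [_ balH1].
have W_eq_iff (g1 g2 : complete_graph n) (h1 h2 : H) :
    g1 != g2 -> dist h1 h2 = l - 1 ->
    #|@W (cartesian_product (complete_graph n) H) (g1, h1) (g2, h2)| =
    #|@W (cartesian_product (complete_graph n) H) (g2, h2) (g1, h1)| <->
    #|closer_by_one h1 h2| = #|closer_by_one h2 h1|.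
  move=> g12 /balH1 eqW.
  have := card_W_distinct_layers h1 h2 g12.
  rewrite eq_sym in g12; have := card_W_distinct_layers h2 h1 g12.
  rewrite equidistantC eqW; lia.
pose g1 : complete_graph n := Ordinal (ltnW n2).
pose g2 : complete_graph n := Ordinal n2.
split=> [[_ balKH] h1 h2 h12 | balD].
  have g12 : g1 != g2 by [].
  apply/(W_eq_iff g1 g2 h1 h2 g12 h12)/balKH.
  by rewrite dist_KH g12 h12; lia.
split.
  pose layer (h : H) : cartesian_product (complete_graph n) H := (g1, h).
  apply: leq_trans diamH (diam_isometry (f := layer) _) => u v.
  by rewrite dist_KH eqxx.
move=> [a h1] [b h2]; rewrite dist_KH.
have [-> /= /balH eqW | ab /= h12] := eqVneq a b.
  by rewrite !card_W_same_layer eqW.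
have {}h12 : dist h1 h2 = l - 1 by lia.
by apply/(W_eq_iff _ _ _ _ ab h12)/balD.
Qed.
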